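(* Let $p\ge 5$ be a prime and let $t$ be the smallest prime divisor of $(p-1)/2$. Then the maximal cross-correlation $C(\mathcal{W}_p)$ of the family $\mathcal{W}_p$ of Welch Costas permutations of $\{1,\ldots,p-1\}$ satisfies $$C(\mathcal{W}_p)\le 1+\left\lfloor\left(1-\frac{2}{p-1}\right)p^{1/2}\right\rfloor \quad\text{if $p$ is a safe prime},$$ and $$C(\mathcal{W}_p)=\frac{p-1}{t}\quad\text{otherwise}.$$
   Context: For a positive integer $n$ and two maps $f_1,f_2:\{1,\ldots,n\}\to\{1,\ldots,n\}$, the cross-correlation $C_{f_1,f_2}(u,v)$ at $(u,v)\in\mathbb{Z}^2$ with $1-n\le u,v\le n-1$ is the number of integers $x\in\{\max\{1,1-u\},\ldots,\min\{n,n-u\}\}$ with $f_1(x)+v=f_2(x+u)$. For a family $\mathcal{F}$ of permutations of $\{1,\ldots,n\}$, the maximal cross-correlation is $C(\mathcal{F})=\max_{u,v}\max_{f_1,f_2\in\mathcal{F},\,f_1\ne f_2}C_{f_1,f_2}(u,v)$, the outer maximum over $1-n\le u,v\le n-1$. For a prime $p$ and a primitive root $g$ modulo $p$, $\pi_g$ is the permutation of $\{1,\ldots,p-1\}$ with $\pi_g(i)\equiv g^i \bmod p$. The Welch family is $\mathcal{W}_p=\{\pi_g: g \text{ a primitive root modulo } p\}$ (a family of permutations of $\{1,\ldots,p-1\}$, so $n=p-1$). A prime $p$ is a safe prime if $(p-1)/2$ is also prime. *)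

(* Defs.v *)
From mathcomp Require Import all_boot all_order all_fingroup all_algebra zify.

Set Implicit Arguments.
Unset Strict Implicit.
Unset Printing Implicit Defensive.

Import Order.TTheory GRing.Theory Num.Theory.
Local Open Scope ring_scope.

(* The set {1, ..., n} is represented by 'I_n, the ordinal i standing for the
   integer i + 1. *)
Definition label n (i : 'I_n) : int := i.+1%:Z.

(* [y] stands for x + u, so that x is restricted to those points of {1, ..., n}
   for which x + u is again in {1, ..., n}; see [label_shift]. *)
Definition xcorr n (f1 f2 : 'I_n -> 'I_n) (u v : int) : nat :=
  #|[set x : 'I_n | [exists y : 'I_n,
       (label x + u == label y) && (label (f1 x) + v == label (f2 y))]]|.

Lemma label_shift n (x : 'I_n) (u : int) :
  [exists y : 'I_n, label x + u == label y]
  = (Num.max 1 (1 - u) <= label x <= Num.min n%:Z (n%:Z - u)).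
Proof.
rewrite /label ge_max le_min; apply/existsP/idP => [[y /eqP h]|h].
  by have := ltn_ord x; have := ltn_ord y; lia.
have hy : (absz (x%:Z + u)%R < n)%N by lia.
by exists (Ordinal hy) => /=; lia.
Qed.

(* The integers from 1 - n to n - 1. *)
Definition shifts (n : nat) : seq int :=
  [seq i%:Z - n%:Z | i <- iota 1 (2 * n).-1].

Lemma mem_shifts n (u : int) :
  (u \in shifts n) = (1 - n%:Z <= u <= n%:Z - 1).
Proof.
apply/mapP/idP => [[i]|h]; first by rewrite mem_iota => hi ->; lia.
by exists (absz (u + n%:Z)); [rewrite mem_iota|]; lia.
Qed.

(* This is 0 for a family with fewer than two members. *)
Definition max_xcorr n (F : {set 'S_n}) : nat :=
  (\max_(u <- shifts n) \max_(v <- shifts n)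
     \max_(f1 in F) \max_(f2 in F | f1 != f2) xcorr f1 f2 u v)%N.

(* For p prime, a primitive root g modulo p is an element of 'F_p of
   multiplicative order p - 1, and congruence modulo p is equality in 'F_p. *)
Definition is_welch (p : nat) (g : 'F_p) (s : 'S_p.-1) : bool :=
  [forall i : 'I_p.-1, (s i).+1%:R == g ^+ i.+1].

Definition welch_family (p : nat) : {set 'S_p.-1} :=
  [set s : 'S_p.-1 |
     [exists g : 'F_p, (p.-1).-primitive_root g && is_welch g s]].

Definition safe_prime (p : nat) : bool := prime p && prime (p.-1 %/ 2).

(* Main.v *)
Require Import Defs.
From mathcomp Require Import all_boot all_order all_fingroup all_algebra reals.
From mathcomp Require Import cyclic finfield zify ring lra.
Import Order.TTheory GRing.Theory Num.Theory.
Local Open Scope ring_scope.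

(** If h = g^r, coincidences of pi_g shifted by v with pi_h shifted by u are
    nonzero solutions y = g^x in F_p of y + v = c y^r, where c = h^u. Let N be
    their number.

    If v <> 0 in F_p, a pair of distinct solutions y, z is determined by its
    ratio w = z / y, since eliminating c gives y (w - w^r) = v (w^r - 1). Here
    w^r <> w, so w avoids 0, 1 and -1 (r is odd), whence N (N - 1) <= p - 3.
    No character sums are needed: for integers N this already yields
    N <= 1 + (1 - 2 / (p - 1)) sqrt p, and also N <= (p - 1) / t when
    (p - 1) / 2 is composite, because then t^2 <= (p - 1) / 2.

    If v = 0 in F_p, ratios of solutions are roots of unity of order dividing
    d = gcd (p - 1, r - 1), an even proper divisor of p - 1; so N <= d, which
    is 2 for a safe prime and at most (p - 1) / t in general.

    Equality holds at u = v = 0 for r = 1 + j (p - 1) / t with j = 1 or 2. *)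

(** * Nonzero solutions of y + v = c y^r in a finite field *)

Lemma card_offdiag (T : finType) (A : {set T}) :
  #|[set z : T * T | [&& z.1 \in A, z.2 \in A & z.1 != z.2]]|
    = (#|A| * #|A|.-1)%N.
Proof.
have -> : [set z : T * T | [&& z.1 \in A, z.2 \in A & z.1 != z.2]]
    = setX A A :\: [set (y, y) | y in A].
  apply/setP => -[y z]; rewrite !inE /=.
  have [->|yz] := eqVneq y z.
    rewrite !andbF; symmetry; apply/negbTE/nandP.
    case zA: (z \in A); last by right.
    by left; rewrite negbK; apply/imsetP; exists z.
  rewrite andbT; case: imsetP => [[x _ [xy xz]]|_] //=.
  by rewrite xy xz eqxx in yz.
rewrite cardsD (setIidPr _).
  by rewrite cardsX card_imset => [|x y [] //]; rewrite -subn1 mulnBr muln1.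
by apply/subsetP => _ /imsetP[y yA ->]; rewrite inE /= yA.
Qed.

Definition affine_monomial_roots (F : finFieldType) (r : nat) (c v : F) : {set F} :=
  [set y : F | (y != 0) && (y + v == c * y ^+ r)].

Lemma card_affine_monomial_roots (F : finFieldType) (r : nat) (c v : F) :
  odd r -> v != 0 -> (1 : F) != -1 ->
  (#|affine_monomial_roots F r c v| * #|affine_monomial_roots F r c v|.-1
     <= #|F| - 3)%N.
Proof.
move=> r_odd v0 n11; set S := affine_monomial_roots F r c v.
pose D := [set z : F * F | [&& z.1 \in S, z.2 \in S & z.1 != z.2]].
have cardD : #|D| = (#|S| * #|S|.-1)%N by exact: card_offdiag.
pose W := ~: [set 0; 1; -1 : F].
have cardW : #|W| = (#|F| - 3)%N.
  rewrite cardsCs setCK setUC !cardsU1 cards1 !inE.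
  by rewrite oppr_eq0 oner_eq0 [-1 == 1]eq_sym [0 == 1]eq_sym oner_eq0 (negbTE n11).
pose q (z : F * F) := z.2 / z.1.
have qE y z : (y, z) \in D ->
    let w := z / y in
    [/\ y != 0, z = w * y, w \in W, w ^+ r != w
      & y * (w - w ^+ r) = v * (w ^+ r - 1)].
  rewrite inE /= 2!inE => /and3P[/andP[y0 /eqP yS] /andP[z0 /eqP zS] yz].
  set w := z / y.
  have zE : z = w * y by rewrite mulfVK.
  have w0 : w != 0 by rewrite mulf_neq0 ?invr_eq0.
  have w1 : w != 1 by apply: contra yz => /eqP w1; rewrite zE w1 mul1r.
  have E : y * (w - w ^+ r) = v * (w ^+ r - 1).
    (* Both sides equal c z^r, which eliminates c. *)
    have : w * y + v = w ^+ r * (y + v).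
      by rewrite -zE zS yS zE exprMn mulrCA.
    move/eqP; rewrite -subr_eq0 => /eqP e.
    by apply/eqP; rewrite -subr_eq0; apply/eqP; rewrite -[RHS]e; ring.
  (* If w^r = w, then v (w^r - 1) = 0 by [E], and v <> 0 forces w = 1. *)
  have wr : w ^+ r != w.
    apply: contra w1 => /eqP wr; move/eqP: E.
    by rewrite wr subrr mulr0 eq_sym mulf_eq0 (negbTE v0) /= subr_eq0.
  split=> //; rewrite !inE !negb_or w0 w1 /=.
  by apply: contra wr => /eqP ->; rewrite -signr_odd r_odd expr1.
rewrite -cardD -cardW -(card_in_imset (f := q)).
  apply/subset_leq_card/subsetP => _ /imsetP[[y z] yzD ->].
  by have [] := qE y z yzD.
move=> [y z] [y' z'] yzD yzD'; rewrite /q /= => qq.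
have [y0 zE _ wr E] := qE _ _ yzD.
have [y0' zE' _ _ E'] := qE _ _ yzD'.
suff yy : y = y' by rewrite zE zE' -qq yy.
move: E'; rewrite -qq -E => /mulIf -> //.
by rewrite subr_eq0 eq_sym.
Qed.

Lemma expf_card_pred (F : finFieldType) (w : F) : w != 0 -> w ^+ #|F|.-1 = 1.
Proof.
move=> w0; apply: (mulIf w0); rewrite mul1r -exprSr prednK ?expf_card //.
exact: ltnW (card_finNzRing_gt1 F).
Qed.

Lemma card_monomial_roots (F : finFieldType) (r : nat) (c : F) :
  (1 < r)%N ->
  (#|affine_monomial_roots F r c 0%R| <= gcdn #|F|.-1 r.-1)%N.
Proof.
move=> r_gt1; set S := affine_monomial_roots F r c 0.
have [->|[y0 y0S]] := set_0Vmem S; first by rewrite cards0.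
set d := gcdn _ _.
have d_gt0 : (0 < d)%N by rewrite gcdn_gt0 orbC; lia.
pose rs := [seq y / y0 | y <- enum S].
move: (y0S); rewrite inE addr0 => /andP[y0n0 /eqP y0E].
have -> : #|S| = size rs by rewrite size_map -cardE.
apply: (@max_unity_roots F) => //; last first.
  by rewrite map_inj_uniq ?enum_uniq //; apply: mulIf; rewrite invr_eq0.
apply/allP => _ /mapP[y + ->]; rewrite mem_enum inE addr0 => /andP[yn0 /eqP yE].
set w := y / y0.
have wr : w ^+ r.-1 = 1.
  have w0 : w != 0 by rewrite mulf_neq0 ?invr_eq0.
  apply: (mulIf w0); rewrite mul1r -exprSr prednK; last by lia.
  have c0 : c != 0 by apply: contra y0n0 => /eqP c0; rewrite y0E c0 mul0r.
  transitivity ((c * y ^+ r) / (c * y0 ^+ r)); last by rewrite -yE -y0E.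
  by rewrite expr_div_n -mulf_div divff // mul1r.
have wn : w ^+ #|F|.-1 = 1 by apply: expf_card_pred; rewrite mulf_neq0 ?invr_eq0.
(* Bezout writes a multiple of r - 1 as a multiple of [#|F|.-1] plus [d]; raising w to both sides
   gives w^d = 1. *)
rewrite unity_rootE /d.
case: (egcdnP #|F|.-1 (m := r.-1)) => [|k k' E _]; first by lia.
rewrite gcdnC; apply/eqP; have := congr1 (fun m => w ^+ m) E.
by rewrite exprD ![(_ * r.-1)%N]mulnC ![(_ * _.-1)%N]mulnC !exprM wr wn !expr1n mul1r.
Qed.

(** * Coincidences of two Welch permutations *)

Lemma welchE (p : nat) (g : 'F_p) (s : 'S_p.-1) (i : 'I_p.-1) :
  is_welch g s -> (label (s i))%:~R = g ^+ i.+1.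
Proof. by move=> /forallP /(_ i) /eqP <-; rewrite /label -pmulrn. Qed.

(** The map x -> g^x is injective on {1, ..., p - 1} and sends coincidences to solutions, because
    h^(x + u) = h^u (g^x)^r. As u may be negative, h^u is an integer power. *)
Lemma xcorr_welch_le_roots (p : nat) (g h : 'F_p) (f1 f2 : 'S_p.-1) (r : nat)
    (u v : int) :
  (p.-1).-primitive_root g -> h = g ^+ r -> is_welch g f1 -> is_welch h f2 ->
  (xcorr f1 f2 u v <= #|affine_monomial_roots 'F_p r (h ^ u)%R v%:~R|)%N.
Proof.
move=> gP hE gf1 hf2.
have n0 : (0 < p.-1)%N := prim_order_gt0 gP.
have h0 : h != 0 by rewrite hE expf_neq0 ?(prim_root_eq0 gP) -?lt0n.
rewrite /xcorr -(card_imset (f := fun x : 'I_p.-1 => g ^+ x.+1)).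
  apply/subset_leq_card/subsetP => _ /imsetP[x + ->].
  rewrite inE => /existsP[y /andP[/eqP xy /eqP fxy]].
  rewrite inE expf_neq0 ?(prim_root_eq0 gP) -?lt0n //=.
  rewrite -exprM mulnC exprM -hE -(welchE p g f1) // -intrD fxy (welchE p h f2) //.
  by rewrite exprnP -[y.+1%:Z]/(label y) -xy expfzDr // mulrC.
move=> x y /eqP; rewrite (eq_prim_root_expr gP) -(addn1 x) -(addn1 y) eqn_modDr.
by rewrite !modn_small // => /eqP /val_inj.
Qed.

Lemma welch_inj (p : nat) (g : 'F_p) (f1 f2 : 'S_p.-1) :
  prime p -> is_welch g f1 -> is_welch g f2 -> f1 = f2.
Proof.
move=> hp /forallP gf1 /forallP gf2; apply/permP => i; apply/val_inj.
have /eqP := eqP (gf1 i); rewrite -(eqP (gf2 i)) => /eqP /(congr1 val) /=.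
rewrite !val_Fp_nat // !modn_small; first by case.
all: by rewrite -ltn_predRL.
Qed.

(** The first alternative comes from v <> 0 in F_p, the second from v = 0 with d = gcd (p - 1, r -
    1). *)
Lemma xcorr_welch_family (p : nat) (f1 f2 : 'S_p.-1) (u v : int) :
  prime p -> (2 < p)%N -> f1 \in welch_family p -> f2 \in welch_family p ->
  f1 != f2 ->
  (xcorr f1 f2 u v * (xcorr f1 f2 u v).-1 <= p - 3)%N \/
  exists d, [/\ (2 %| d)%N, (d %| p.-1)%N, (d < p.-1)%N & (xcorr f1 f2 u v <= d)%N].
Proof.
move=> hp p_gt2; rewrite !inE => /existsP[g /andP[gP gf1]] /existsP[h /andP[hP hf2]] f12.
have [[r /= r_lt] hE] := prim_rootP gP (prim_expr_order hP).
have r_co : coprime r p.-1 by rewrite -(prim_root_exp_coprime _ gP) -hE.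
have p_odd : odd p by case: (even_prime hp) p_gt2 => [->|].
have r_odd : odd r.
  rewrite -coprimen2; apply: coprime_dvdr r_co; rewrite dvdn2.
  by case: (p) hp p_odd => //= ? ? ->.
(* r = 1 would give h = g, hence f1 = f2. *)
have r_gt1 : (1 < r)%N.
  case: (r) r_odd hE => [|[|]] // _ hE; case/negP: f12; apply/eqP.
  by apply: (welch_inj p g) => //; rewrite hE expr1 in hf2.
have n0 : (0 < p.-1)%N := prim_order_gt0 gP.
have n11 : (1 : 'F_p) != -1.
  rewrite -subr_eq0 opprK -[1 + 1]/(2%:R) -(dvdn_pcharf (pchar_Fp hp)).
  by rewrite gtnNdvd.
have := xcorr_welch_le_roots p g h f1 f2 r u v gP hE gf1 hf2.
set N := xcorr _ _ _ _; have [v0|v0] := eqVneq (v%:~R : 'F_p) 0.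
  rewrite v0 => le_N; right; exists (gcdn p.-1 r.-1); split.
  - rewrite dvdn_gcd !dvdn2; case: (p) p_gt2 p_odd => //= ? _ ->.
    by case: (r) r_odd => //= ? ->.
  - exact: dvdn_gcdl.
  - by apply: leq_ltn_trans (dvdn_leq _ (dvdn_gcdr _ _)) _; lia.
  - have := card_monomial_roots 'F_p r (h ^ u) r_gt1; rewrite card_Fp //.
    exact: leq_trans.
move=> le_N; left.
have := card_affine_monomial_roots 'F_p r (h ^ u) v%:~R r_odd v0 n11.
rewrite card_Fp //; apply: leq_trans; apply: leq_mul => //.
by rewrite -!subn1 leq_sub2r.
Qed.

(** * A pair with at least (p - 1) / t coincidences *)

Lemma Fp_prim_root (p : nat) :
  prime p -> exists g : 'F_p, (p.-1).-primitive_root g.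
Proof.
move=> hp; pose rs := enum [set~ 0 : 'F_p].
suff /hasP[g _ gP] : has (p.-1).-primitive_root rs by exists g.
apply: has_prim_root; rewrite ?enum_uniq //.
- by rewrite -subn1 subn_gt0 prime_gt1.
- apply/allP => x; rewrite mem_enum !inE => x0.
  by have := expf_card_pred _ x x0; rewrite card_Fp // unity_rootE => ->.
- by rewrite -cardE cardsC1 card_Fp.
Qed.

Lemma welch_exists (p : nat) (g : 'F_p) :
  prime p -> (p.-1).-primitive_root g -> exists s : 'S_p.-1, is_welch g s.
Proof.
move=> hp gP; have n0 : (0 < p.-1)%N := prim_order_gt0 gP.
have pos (i : 'I_p.-1) : (0 < (g ^+ i.+1 : 'F_p))%N.
  rewrite lt0n; apply/negP => /eqP gi0.
  have : g ^+ i.+1 != 0 by rewrite expf_neq0 ?(prim_root_eq0 gP) -?lt0n.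
  by case/eqP; apply: val_inj.
have lt_p (i : 'I_p.-1) : ((g ^+ i.+1 : 'F_p).-1 < p.-1)%N.
  rewrite -ltnS prednK ?pos // prednK ?prime_gt0 //.
  by rewrite -[X in (_ < X)%N](Fp_cast hp) ltn_ord.
pose f (i : 'I_p.-1) := Ordinal (lt_p i).
have fE (i : 'I_p.-1) : (f i).+1%:R = g ^+ i.+1 by rewrite /= prednK ?natr_Zp ?pos.
have f_inj : injective f.
  move=> x y fxy; have /eqP := fE x; rewrite fxy fE.
  rewrite (eq_prim_root_expr gP) -(addn1 x) -(addn1 y) eqn_modDr.
  by rewrite !modn_small // => /eqP /val_inj.
by exists (perm f_inj); apply/forallP => i; rewrite permE fE.
Qed.

(* j = 1 fails only when t divides 1 + e. *)
Lemma ex_coprime_shift (e t : nat) :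
  prime t -> ~~ odd e -> exists2 j : nat, ~~ (t %| j)%N & coprime (1 + e * j) (e * t).
Proof.
move=> ht e_even; have t1 := prime_gt1 ht.
have cop j : ~~ (t %| 1 + e * j)%N -> coprime (1 + e * j) (e * t).
  move=> tj; rewrite coprimeMr andbC coprime_sym prime_coprime // tj /=.
  by rewrite coprime_sym /coprime addnC mulnC gcdnMDl gcdn1.
have [te|te] := boolP (t %| 1 + e)%N; last first.
  by exists 1%N; [rewrite gtnNdvd|apply: cop; rewrite muln1].
have t_odd : odd t by apply: (dvdn_odd te); rewrite oddD /= e_even.
exists 2%N; first by rewrite dvdn_prime2 //; apply: contraL t_odd => /eqP ->.
apply: cop; apply/negP => t2; have : (t %| (1 + e) * 2)%N by rewrite dvdn_mulr.
have -> : ((1 + e) * 2 = 1 + (1 + e * 2))%N by lia.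
by rewrite dvdn_addl // dvdn1 gtn_eqF.
Qed.

(** With r = 1 + e j, g^(r x) = g^x whenever t divides x, since p - 1 = e t then divides e j x.
    There are e such x in {1, ..., p - 1}. *)
Lemma welch_xcorr_attained (p e t : nat) :
  prime p -> prime t -> ~~ odd e -> (p.-1 = e * t)%N ->
  exists f1 f2 : 'S_p.-1,
    [/\ f1 \in welch_family p, f2 \in welch_family p, f1 != f2
      & (e <= xcorr f1 f2 0 0)%N].
Proof.
move=> hp ht e_even pE.
have [g gP] := Fp_prim_root p hp.
have n0 : (0 < p.-1)%N := prim_order_gt0 gP.
have t0 := prime_gt0 ht.
have e0 : (0 < e)%N by move: n0; rewrite pE muln_gt0 => /andP[].
have [j tj co] := ex_coprime_shift e t ht e_even.
set r := (1 + e * j)%N in co.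
have hP : (p.-1).-primitive_root (g ^+ r) by rewrite prim_root_exp_coprime // pE.
have [f1 gf1] := welch_exists p g hp gP.
have [f2 hf2] := welch_exists p (g ^+ r) hp hP.
exists f1, f2; split.
- by rewrite inE; apply/existsP; exists g; rewrite gP.
- by rewrite inE; apply/existsP; exists (g ^+ r); rewrite hP.
(* Equality at the first point would give g = g^r, so e t would divide e j, and t would divide j. *)
- apply/eqP => f12; have := welchE p g f1 (Ordinal n0) gf1.
  rewrite f12 (welchE p _ f2 _ hf2) /= !expr1 -[RHS]expr1 => /eqP.
  rewrite (eq_prim_root_expr gP) -[X in _ == X %[mod _]]addn0 eqn_modDl mod0n.
  by rewrite pE -/(dvdn _ _) dvdn_pmul2l // (negbTE tj).
(* The point t (k + 1) of {1, ..., p - 1} has index one less. *)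
have lt_n (k : 'I_e) : ((t * k.+1).-1 < p.-1)%N.
  by rewrite prednK ?muln_gt0 ?t0 // pE mulnC leq_mul.
pose x k := Ordinal (lt_n k).
have x_inj : injective x.
  move=> k k' /(congr1 val) /= kk; apply: val_inj => /=; nia.
rewrite -[leqLHS]card_ord -cardsT -(card_imset _ x_inj).
apply/subset_leq_card/subsetP => _ /imsetP[k _ ->].
rewrite inE; apply/existsP; exists (x k); rewrite !addr0 eqxx /=.
have xE : (x k).+1 = (t * k.+1)%N by rewrite /= prednK // muln_gt0 t0.
have E : (f1 (x k)).+1%:R = (f2 (x k)).+1%:R :> 'F_p.
  rewrite (eqP (forallP gf1 _)) (eqP (forallP hf2 _)) -exprM xE.
  apply/eqP; rewrite (eq_prim_root_expr gP) eq_sym mulnDl mul1n.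
  have -> : (e * j * (t * k.+1) = j * k.+1 * p.-1)%N by rewrite pE; lia.
  by rewrite addnC modnMDl.
move/(congr1 val): E; rewrite /= !val_Fp_nat // !modn_small ?/label => [->//||].
all: by rewrite -ltn_predRL.
Qed.

(** * Bounds for the maximum over the family *)

(** A finite maximum is one of its values or the default 0, so [P] passes to it. *)
Lemma max_xcorr_ind (n : nat) (F : {set 'S_n}) (P : nat -> Prop) :
  P 0%N ->
  (forall f1 f2 u v, f1 \in F -> f2 \in F -> f1 != f2 -> P (xcorr f1 f2 u v)) ->
  P (max_xcorr F).
Proof.
move=> P0 Pxcorr.
have Pmax a b : P a -> P b -> P (maxn a b) by case: leqP.
apply: (big_ind P) => // u _; apply: (big_ind P) => // v _.
apply: (big_ind P) => // f1 f1F; apply: (big_ind P) => // f2 /andP[f2F f12].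
exact: Pxcorr.
Qed.

Lemma xcorr_le_max_xcorr (n : nat) (F : {set 'S_n}) (f1 f2 : 'S_n) (u v : int) :
  u \in shifts n -> v \in shifts n -> f1 \in F -> f2 \in F -> f1 != f2 ->
  (xcorr f1 f2 u v <= max_xcorr F)%N.
Proof.
move=> un vn f1F f2F f12; rewrite /max_xcorr.
apply: leq_trans (leq_bigmax_seq _ un isT).
apply: leq_trans (leq_bigmax_seq _ vn isT).
apply: leq_trans (leq_bigmax_cond _ f1F).
by apply: leq_bigmax_cond; rewrite f2F.
Qed.

(* With q = p - 3 and m = N - 1 >= 1, the hypothesis gives m^2 <= q - 1, and
   (q - 1) (q + 2)^2 = q^2 (q + 3) - 4. *)
Lemma le_floor_of_mul_pred (R : realType) (p N : nat) :
  (5 <= p)%N -> (N * N.-1 <= p - 3)%N ->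
  N%:Z <= 1 + Num.floor ((1 - 2 / (p%:R - 1)) * Num.sqrt (p%:R : R)).
Proof.
move=> p5 NN; rewrite -lerBlDl floor_ge_int.
have [q pE] : exists q, p = (q + 3)%N by exists (p - 3)%N; lia.
have q2 : (2 <= q)%N by lia.
have q0 : 0 <= q%:R :> R by [].
have -> : 1 - 2 / (p%:R - 1) = q%:R / (q%:R + 2) :> R.
  by rewrite pE natrD; field; rewrite !lt0r_neq0 //; lra.
(* For N <= 1 the left side is at most 0 and the right side is nonnegative. *)
case: N NN => [|[|M]] NN.
- by apply: (@le_trans _ _ 0); [lra|rewrite mulr_ge0 ?sqrtr_ge0 ?divr_ge0 ?addr_ge0].
- by rewrite subrr mulr_ge0 ?sqrtr_ge0 ?divr_ge0 ?addr_ge0.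
set m := M.+1.
have -> : (m.+1%:Z - 1)%:~R = m%:R :> R by rewrite -addn1 PoszD addrK.
rewrite mulrAC ler_pdivlMr ?ltr_wpDl //.
have mq : (m * m <= q - 1)%N by rewrite /m; nia.
have sq : ((m * (q + 2)) ^ 2 <= q ^ 2 * p)%N by rewrite pE; nia.
rewrite -ler_sqr ?nnegrE ?mulr_ge0 ?sqrtr_ge0 ?addr_ge0 //.
rewrite [leRHS]exprMn sqr_sqrtr // -natrD -natrM -!natrX -natrM ler_nat.
exact: sq.
Qed.

Theorem theorem1 (R : realType) (p : nat) (hp : prime p) (hp5 : (5 <= p)%N) :
  (safe_prime p ->
     (max_xcorr (welch_family p))%:Z
       <= 1 + Num.floor ((1 - 2 / (p%:R - 1)) * Num.sqrt (p%:R : R)))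
  /\
  (~~ safe_prime p ->
     max_xcorr (welch_family p) = (p.-1 %/ pdiv (p.-1 %/ 2))%N).
Proof.
have p_odd : odd p by case: (even_prime hp) hp5 => [->|].
set k := (p.-1 %/ 2)%N.
have p1E : p.-1 = (2 * k)%N by rewrite /k; lia.
have k2 : (2 <= k)%N by lia.
have even_dvd d : (2 %| d)%N -> (d %| p.-1)%N -> (d < p.-1)%N ->
    exists m d', [/\ k = (m * d')%N, d = (2 * d')%N & (1 < m)%N].
  move=> /dvdnP[d' ->] /dvdnP[m mE] lt_d; exists m, d'; split; nia.
split=> [/andP[_ k_prime]|].
  apply: le_floor_of_mul_pred => //.
  apply: (max_xcorr_ind _ _ (fun N => N * N.-1 <= p - 3)%N) => //.
  move=> f1 f2 u v f1W f2W f12.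
  have [//|[d [d2 dp lt_d le_d]]] :=
    xcorr_welch_family p f1 f2 u v hp (ltnW (ltnW hp5)) f1W f2W f12.
  have [m [d' [kE dE m1]]] := even_dvd d d2 dp lt_d.
  have : (m %| k)%N by rewrite kE dvdn_mulr.
  (* Since k is prime and m > 1 divides it, m = k and d = 2; then N (N - 1) <= 2 <= p - 3. *)
  have /primeP[_ /[apply]] := k_prime.
  rewrite gtn_eqF //= => /eqP mk; nia.
rewrite /safe_prime hp /= -/k => k_nprime.
set t := pdiv k; have t_prime : prime t := pdiv_prime k2.
have /dvdnP[s kE] : (t %| k)%N := pdiv_dvd k.
(* If s < t, then k = s t < t^2, and k would be prime. *)
have ts : (t <= s)%N.
  rewrite leqNgt; apply: contra k_nprime => lt_st.
  by apply: ltn_pdiv2_prime; rewrite -/t; nia.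
have p1E' : p.-1 = (2 * s * t)%N by lia.
have -> : (p.-1 %/ t)%N = (2 * s)%N by rewrite p1E' mulnK ?prime_gt0.
apply/eqP; rewrite eqn_leq; apply/andP; split.
  apply: (max_xcorr_ind _ _ (fun N => N <= 2 * s)%N) => // f1 f2 u v f1W f2W f12.
  have [le_N|[d [d2 dp lt_d le_d]]] :=
    xcorr_welch_family p f1 f2 u v hp (ltnW (ltnW hp5)) f1W f2W f12.
    (* N > 2 s would give N (N - 1) >= 2 s (2 s + 1) > 2 s t = p - 1. *)
    by rewrite leqNgt; apply/negP => lt_N; nia.
  have [m [d' [mE dE m1]]] := even_dvd d d2 dp lt_d.
  (* Hence d = 2 k / m <= 2 k / t = 2 s. *)
  have tm : (t <= m)%N by apply: pdiv_min_dvd => //; rewrite mE dvdn_mulr.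
  have t0 := prime_gt0 t_prime.
  by apply: leq_trans le_d _; nia.
have [|f1 [f2 [f1W f2W f12]]] := welch_xcorr_attained p (2 * s) t hp t_prime _ p1E'.
  by rewrite oddM.
by move=> /leq_trans; apply; apply: xcorr_le_max_xcorr; rewrite ?mem_shifts //; lia.
Qed.
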